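(* Let $A$ be a Banach algebra, let $B$ be a Banach $A$-bimodule, and let $n\ge 2$ be an odd number. Then: (1) If $B^{(n)}B^{(n-1)}\subseteq A^{(n-2)}$, then $Z^\ell_{A^{(n-1)}}(B^{(n-1)})=\tilde Z^\ell_{A^{(n-1)}}(B^{(n-1)})$. (2) If $B^{(n)}A^{(n-1)}\subseteq B^{(n-2)}$ and $B^{(n-1)}$ has a left unit $A^{(n-1)}$-module, then $B$ is reflexive.
   Context: For a bounded bilinear map $m:X\times Y\to Z$ of normed spaces define $m^*:Z^*\times X\to Y^*$ by $\langle m^*(z',x),y\rangle=\langle z',m(x,y)\rangle$, and $m^{**}=(m^* )^*:Y^{**}\times Z^*\to X^*$, $m^{***}=(m^{**})^*:X^{**}\times Y^{**}\to Z^{**}$, i.e. $\langle m^{**}(y'',z'),x\rangle=\langle y'',m^*(z',x)\rangle$ and $\langle m^{***}(x'',y''),z'\rangle=\langle x'',m^{**}(y'',z')\rangle$. $A^{(k)},B^{(k)}$ denote the $k$-th duals, $A^{(0)}=A$, $B^{(0)}=B$. For even $k\ge 2$, $A^{(k)}$ is a Banach algebra under the first Arens product, i.e. the map $m^{***}$ obtained from the product $m$ of $A^{(k-2)}$, and $B^{(k)}$ is a Banach $A^{(k)}$-bimodule with left and right actions $m^{***}$ obtained from the left and right actions $m$ of $A^{(k-2)}$ on $B^{(k-2)}$; both actions are written by juxtaposition. Spaces are identified with their canonical images in their second duals. For $n$ odd, $b^{(n)}\in B^{(n)}$, $b^{(n-1)}\in B^{(n-1)}$, $a^{(n-1)}\in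 A^{(n-1)}$: $b^{(n)}b^{(n-1)}\in A^{(n)}$ is given by $\langle b^{(n)}b^{(n-1)},a^{(n-1)}\rangle=\langle b^{(n)},b^{(n-1)}a^{(n-1)}\rangle$, and $b^{(n)}a^{(n-1)}\in B^{(n)}$ by $\langle b^{(n)}a^{(n-1)},b^{(n-1)}\rangle=\langle b^{(n)},a^{(n-1)}b^{(n-1)}\rangle$. Products of sets denote sets of all products. $Z^\ell_{A^{(n-1)}}(B^{(n-1)})$ (resp. $\tilde Z^\ell_{A^{(n-1)}}(B^{(n-1)})$) is the set of $b\in B^{(n-1)}$ such that $a\mapsto ba$, $A^{(n-1)}\to B^{(n-1)}$, is weak*-to-weak* (resp. weak*-to-weak) continuous; weak* topologies are with respect to the preduals $A^{(n-2)}$, $B^{(n-2)}$. $B^{(n-1)}$ has a left unit $A^{(n-1)}$-module if there is a left unit element $e$ of the algebra $A^{(n-1)}$ such that $eb=b$ for all $b\in B^{(n-1)}$. *)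

(* Defs.v *)
From HB Require Import structures.
From mathcomp Require Import all_boot all_order all_algebra.
From mathcomp Require Import complex.
From mathcomp Require Import all_classical all_reals all_analysis.

Set Implicit Arguments.
Unset Strict Implicit.
Unset Printing Implicit Defensive.
Import Order.TTheory GRing.Theory Num.Theory.
Import numFieldNormedType.Exports.
Local Open Scope classical_set_scope.
Local Open Scope ring_scope.

(* Banach spaces over R and over C are treated uniformly. *)
Variant scalars := RealScalars | ComplexScalars.

Definition scalar_field (R : realType) (s : scalars) : numFieldType :=
  match s with
  | RealScalars => R
  | ComplexScalars => R[i]
  end.

(* The order of R[i] is partial, but bounded sets of nonnegative elements still
   have a supremum; the dual norm below relies on this. *)
Lemma scalar_supremums (R : realType) (s : scalars)
    (S : set (scalar_field R s)) (M : scalar_field R s) :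
  S !=set0 -> (forall x, S x -> 0 <= x <= M) -> supremums S !=set0.
Proof.
case: s S M => /= S M [x0 Sx0] SM.
  have supS : has_sup S by split; [exists x0 | exists M => x /SM /andP[]].
  exists (sup S); split; first exact: sup_upper_bound.
  by move=> y Sy; apply: ge_sup => //; exists x0.
have Im0 (x : R[i]) : S x -> complex.Im x = 0.
  by move=> /SM /andP[]; rewrite lecE => /andP[/eqP].
have SRe : has_sup (@complex.Re R @` S).
  split; first by exists (complex.Re x0), x0.
  exists (complex.Re M) => _ [x Sx <-].
  by have /andP[_] := SM _ Sx; rewrite lecE => /andP[].
exists (sup (@complex.Re R @` S))%:C%C; split=> [x Sx|y Sy].
  by rewrite lecE /= (Im0 _ Sx) eqxx /=; apply: sup_upper_bound => //; exists x.
rewrite lecE /=; have := Sy _ Sx0; rewrite lecE (Im0 _ Sx0) => /andP[-> _] /=.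
apply: ge_sup; first by exists (complex.Re x0), x0.
by move=> _ [x Sx <-]; have := Sy _ Sx; rewrite lecE => /andP[].
Qed.

Section Duality.
Variables (R : realType) (s : scalars).
Local Notation K := (scalar_field R s).

Section Dual.
Variable V : normedModType K.

Definition is_dual (f : V -> K) : Prop := scalar f /\ continuous f.

Definition dual_pred : {pred (V -> K)} := fun f => `[< is_dual f >].

Lemma dual_submod : submod_closed dual_pred.
Proof.
split.
  apply/asboolP; split; last by move=> x; exact: cst_continuous.
  by move=> a x y /=; rewrite mulr0 addr0.
move=> a f g /asboolP[fl fc] /asboolP[gl gc]; apply/asboolP; split.
  move=> b x y.
  rewrite -![(_ + _) _]/(_ *: _ + _) /= fl gl /GRing.scale /=.
  by rewrite !mulrDr addrACA mulrCA.
move=> x; apply: cvgD; last exact: gc.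
by apply: cvgM; [exact: cvg_cst | exact: fc].
Qed.


HB.instance Definition _ := GRing.isSubmodClosed.Build _ _ dual_pred dual_submod.

Record dual := Dual { dual_fun :> V -> K; _ : dual_fun \in dual_pred }.

HB.instance Definition _ := [isSub for dual_fun].
HB.instance Definition _ := [Choice of dual by <:].
HB.instance Definition _ := [SubChoice_isSubLmodule of dual by <:].

Lemma dualP (f : dual) : is_dual f.
Proof. by case: f => f /= fP; exact/asboolP. Qed.

Lemma dual_scalar (f : dual) : scalar f.
Proof. by have [] := dualP f. Qed.

Lemma dual_continuous (f : dual) : continuous f.
Proof. by have [] := dualP f. Qed.

HB.instance Definition _ (f : dual) :=
  GRing.isLinear.Build K V K *%R f (dual_scalar f).

Definition mkdual (f : V -> K) (hf : is_dual f) : dual := Dual (asboolT hf).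

Lemma dual_ext (f g : dual) : f =1 g -> f = g.
Proof. by move=> fg; apply/val_inj/funext. Qed.

Lemma dualDE (f g : dual) x : (f + g) x = f x + g x.
Proof. by []. Qed.

Lemma dualZE (a : K) (f : dual) x : (a *: f) x = a * f x.
Proof. by []. Qed.

Lemma is_dual_bounded (f : V -> K) : scalar f ->
  continuous f <-> exists2 M, 0 <= M & forall x, `|f x| <= M * `|x|.
Proof.
move=> fl; pose g : V -> K^o := f.
pose gL := GRing.isLinear.Build K V K^o *:%R g fl.
pose gl : {linear V -> K^o} := HB.pack g gL.
have -> : continuous f = continuous gl by [].
rewrite -linear_bounded_continuous linear_boundedP; split.
  move=> [M [Mr hM]].
  exists (`|M| + 1) => [|x]; first by rewrite addr_ge0.
  by apply: hM; rewrite (le_lt_trans (real_ler_norm Mr))// ltrDl.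
move=> [M M0 hM]; exists M; split; first exact: ger0_real.
by move=> r Mr x; rewrite (le_trans (hM x))// ler_wpM2r// ltW.
Qed.

Lemma dual_bounded (f : dual) :
  exists2 M, 0 <= M & forall x, `|f x| <= M * `|x|.
Proof. exact/(is_dual_bounded (dual_scalar f))/dual_continuous. Qed.

Definition dual_values (f : dual) : set K :=
  [set `|f x| | x in [set x | `|x| <= 1]].

Definition dual_norm (f : dual) : K := supremum 0 (dual_values f).

Lemma dual_norm_lub (f : dual) : supremums (dual_values f) (dual_norm f).
Proof.
have [M M0 hM] := dual_bounded f.
have v0 : dual_values f !=set0 by exists `|f 0|, 0 => //=; rewrite normr0.
have : supremums (dual_values f) !=set0.
  apply: (@scalar_supremums _ _ _ M) => // _ [x /= x1 <-].
  by rewrite normr_ge0 (le_trans (hM x))// ler_piMr.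
rewrite /dual_norm /supremum; case: ifPn => [/eqP v|_ [y vy]].
  by case: v0 => y; rewrite v.
by case: xgetP => [z _ //|/(_ y)].
Qed.

Lemma dual_norm_ge (f : dual) x : `|x| <= 1 -> `|f x| <= dual_norm f.
Proof. by move=> x1; have [+ _] := dual_norm_lub f; apply; exists x. Qed.

Lemma dual_norm_le (f : dual) M :
  (forall x, `|x| <= 1 -> `|f x| <= M) -> dual_norm f <= M.
Proof. by move=> h; have [_] := dual_norm_lub f; apply=> _ [x x1 <-]; exact: h. Qed.

Lemma dual_norm_ge0 (f : dual) : 0 <= dual_norm f.
Proof. by rewrite (le_trans (normr_ge0 (f 0)))// dual_norm_ge// normr0. Qed.

Lemma dual_normM (f : dual) x : `|f x| <= dual_norm f * `|x|.
Proof.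
have [->|x0] := eqVneq x 0; first by rewrite linear0 !normr0 mulr0.
have nx : 0 < `|x| by rewrite normr_gt0.
rewrite -ler_pdivrMr//.
have -> : `|f x| / `|x| = `|f (`|x|^-1 *: x)|.
  by rewrite linearZ /= normrM normfV normr_id mulrC.
by rewrite dual_norm_ge// normrZ normfV normr_id mulVf// gt_eqF.
Qed.

Lemma dual_norm_bound (f : dual) M : 0 <= M ->
  (forall x, `|f x| <= M * `|x|) -> dual_norm f <= M.
Proof.
by move=> M0 h; apply: dual_norm_le => x x1; rewrite (le_trans (h x))// ler_piMr.
Qed.

Lemma dual_normD (f g : dual) : dual_norm (f + g) <= dual_norm f + dual_norm g.
Proof.
apply: dual_norm_le => x x1; rewrite dualDE (le_trans (ler_normD _ _))//.
by rewrite lerD// dual_norm_ge.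
Qed.

Lemma dual_normZ (a : K) (f : dual) : dual_norm (a *: f) = `|a| * dual_norm f.
Proof.
have le b g : dual_norm (b *: g) <= `|b| * dual_norm g.
  apply: dual_norm_le => x x1.
  by rewrite dualZE normrM ler_wpM2l// dual_norm_ge.
apply/eqP; rewrite eq_le le /=.
have [->|a0] := eqVneq a 0; first by rewrite normr0 mul0r dual_norm_ge0.
rewrite -ler_pdivlMl ?normr_gt0// -normfV.
by rewrite -{1}(scalerK a0 f) le.
Qed.

Lemma dual_norm_eq0 (f : dual) : dual_norm f = 0 -> f = 0.
Proof.
move=> f0; apply: dual_ext => x; apply/eqP.
by rewrite -normr_le0 (le_trans (dual_normM f x))// f0 mul0r.
Qed.

HB.instance Definition _ :=
  Lmodule_isNormed.Build K dual dual_normD dual_normZ dual_norm_eq0.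

Lemma dual_normE (f : dual) : `|f| = dual_norm f.
Proof. by []. Qed.

End Dual.

Fixpoint iter_dual (V : normedModType K) (k : nat) : normedModType K :=
  if k is k'.+1 then dual (iter_dual V k') else V.

Lemma bidual_map_subproof (V : normedModType K) (v : V) :
  is_dual (fun f : dual V => f v).
Proof.
have l : scalar (fun f : dual V => f v) by [].
split=> //; apply/(is_dual_bounded l).
by exists `|v| => // f; rewrite mulrC dual_normM.
Qed.

Definition bidual_map (V : normedModType K) (v : V) : dual (dual V) :=
  mkdual (bidual_map_subproof v).

Definition reflexive_space (V : normedModType K) : Prop :=
  range (@bidual_map V) = setT.

(* The weak* topology is carried by dual V, with V as predual, and the weak
   topology by V itself; {ptws _ -> _} is the topology of pointwise
   convergence. *)
Definition weak_star (V : normedModType K) : Type :=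
  initial_topology (fun f : dual V => (f : {ptws V -> K})).

HB.instance Definition _ V := Topological.on (weak_star V).

Definition weak (V : normedModType K) : Type :=
  initial_topology (fun v : V => (bidual_map v : {ptws dual V -> K})).

HB.instance Definition _ V := Topological.on (weak V).

(* bounded bilinear maps *)
Record bbilin (X Y Z : normedModType K) := Bbilin {
  bfun :> X -> Y -> Z;
  bfun_linearl : forall y, linear (bfun^~ y);
  bfun_linearr : forall x, linear (bfun x);
  bfun_bounded :
    exists2 M, 0 <= M & forall x y, `|bfun x y| <= M * `|x| * `|y| }.

Section Adjoint.
Variables (X Y Z : normedModType K) (m : bbilin X Y Z).

Lemma adj_subproof (z' : dual Z) (x : X) : is_dual (fun y => z' (m x y)).
Proof.
have l : scalar (fun y => z' (m x y)).
  by move=> a y1 y2 /=; rewrite bfun_linearr dual_scalar.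
split=> //; apply/(is_dual_bounded l); have [M M0 hM] := bfun_bounded m.
exists (`|z'| * (M * `|x|)); first by rewrite !mulr_ge0.
move=> y; rewrite (le_trans (dual_normM _ _))// -mulrA ler_wpM2l ?dual_norm_ge0//.
Qed.

Definition adj_fun (z' : dual Z) (x : X) : dual Y :=
  mkdual (adj_subproof z' x).

Lemma adj_linearl x : linear (adj_fun^~ x).
Proof. by move=> a f g; apply: dual_ext. Qed.

Lemma adj_linearr z' : linear (adj_fun z').
Proof.
move=> a x1 x2; apply: dual_ext => y.
by rewrite dualDE dualZE /= bfun_linearl dual_scalar.
Qed.

Lemma adj_bounded :
  exists2 M, 0 <= M & forall z' x, `|adj_fun z' x| <= M * `|z'| * `|x|.
Proof.
have [M M0 hM] := bfun_bounded m; exists M => // z' x.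
apply: dual_norm_bound; first by rewrite !mulr_ge0.
move=> y /=; rewrite (le_trans (dual_normM _ _))//.
by rewrite -dual_normE [M * _]mulrC -!mulrA ler_wpM2l ?dual_norm_ge0// mulrA hM.
Qed.

(* The map written m^* in the theory of Arens products. When m is the right
   action (b, a) |-> ba of an algebra A on B, adj m is the product
   dual B * B -> dual A; when m is the left action (a, b) |-> ab, adj m is the
   product dual B * A -> dual B. *)
Definition adj : bbilin (dual Z) X (dual Y) :=
  Bbilin adj_linearl adj_linearr adj_bounded.

Lemma adjE z' x y : adj z' x y = z' (m x y).
Proof. by []. Qed.

End Adjoint.

(* The extension of m to the 2j-th duals; j.*2.+2 and j.+1.*2 are convertible,
   so that arens m j.+1 is m^*** for m := arens m j. *)
Fixpoint arens (X Y Z : normedModType K) (m : bbilin X Y Z) (j : nat) :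
    bbilin (iter_dual X j.*2) (iter_dual Y j.*2) (iter_dual Z j.*2) :=
  if j is j'.+1 then adj (adj (adj (arens m j'))) else m.

(* For r the right action of dual V on X = dual W, these are the sets of b such
   that a |-> ba is weak*-to-weak*, resp. weak*-to-weak, continuous. *)
Definition Zl (V W X : normedModType K) (r : bbilin X (dual V) (dual W)) : set X :=
  [set b | continuous ((fun a => r b a) : weak_star V -> weak_star W)].

Definition Zl_tilde (V W X : normedModType K) (r : bbilin X (dual V) (dual W)) :
    set X :=
  [set b | continuous ((fun a => r b a) : weak_star V -> weak (dual W))].

(* not necessarily unital *)
Record banach_algebra := BanachAlgebra {
  alg_space :> completeNormedModType K;
  amul : bbilin alg_space alg_space alg_space;
  amulA : associative amul;
  amul_norm : forall a b, `|amul a b| <= `|a| * `|b| }.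

(* The actions are bounded, with arbitrary bounds. *)
Record banach_bimodule (A : banach_algebra) := BanachBimodule {
  mod_space :> completeNormedModType K;
  lact : bbilin A mod_space mod_space;
  ract : bbilin mod_space A mod_space;
  lactA : forall a1 a2 b, lact (amul A a1 a2) b = lact a1 (lact a2 b);
  ractA : forall b a1 a2, ract b (amul A a1 a2) = ract (ract b a1) a2;
  lractA : forall a1 b a2, lact a1 (ract b a2) = ract (lact a1 b) a2 }.

End Duality.

Arguments Zl {R s} V W {X} r.
Arguments Zl_tilde {R s} V W {X} r.

(* Main.v *)
Require Import Defs.
From mathcomp Require Import all_boot all_order all_algebra.
From mathcomp Require Import ring lra complex.
From mathcomp Require Import all_classical all_reals all_analysis.
Import Order.TTheory GRing.Theory Num.Theory.
Import numFieldNormedType.Exports.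
Local Open Scope classical_set_scope.
Local Open Scope ring_scope.

(** Part (1): put V = A^(n-2) and W = B^(n-2). For b in B^(n-1) and b' in
    B^(n), the functional a |-> <b', ba> on V^* is the product b'b. If all these
    products come from V, all these functionals are weak*-continuous, so that
    every map a |-> ba is weak*-to-weak continuous, and a fortiori
    weak*-to-weak* continuous. Both sets are then the whole of B^(n-1)
    ([Zl_setT], [Zl_tilde_setT]).

    Part (2): with a left unit e, every b' in B^(n) equals b'e, and so comes
    from B^(n-2), which is therefore reflexive ([reflexive_left_unit]). It
    remains to descend from B^(n-2), an odd dual of B, to B. Any dual space V^*
    is a retract of V^***, by the adjoint of the embedding of V in V^**, and
    reflexivity passes to retracts; this leads to B^* ([reflexive_odd_dual]).
    The last step, from B^* to B, uses that B is complete
    ([reflexive_predual]). The canonical image of B in B^** is closed, being an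
    isometric image of a complete space. If it missed some Phi, the
    Hahn-Banach theorem would give a nonzero functional F on B^** that vanishes
    on it; F would be evaluation at some f in B^*, and f = 0 because F vanishes
    on B, a contradiction.

    The Hahn-Banach theorem ([Hahn_Banach_seminorm]) is derived for both scalar
    fields from a statement about real-linear forms ([Hahn_Banach_real]). That
    statement is obtained from minimal sublinear functionals: Zorn's lemma gives
    one below any sublinear functional, and a minimal one is linear. *)

Set Implicit Arguments.
Unset Strict Implicit.
Unset Printing Implicit Defensive.

(** * Real parts of scalars *)

Section Scalars.
Variables (R : realType) (s : scalars).
Local Notation K := (scalar_field R s).

Definition re : K -> R :=
  match s return scalar_field R s -> R with
  | RealScalars => fun x => x
  | ComplexScalars => @complex.Re R
  end.

Definition of_real : R -> K :=
  match s return R -> scalar_field R s with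
  | RealScalars => fun x => x
  | ComplexScalars => fun x => real_complex R x
  end.

End Scalars.
Arguments re {R s}.
Arguments of_real {R} s.

Section ScalarTheory.
Variables (R : realType) (s : scalars).
Local Notation K := (scalar_field R s).
Implicit Types (t u : R) (z w : K).

Lemma of_realK : cancel (of_real s) (@re R s).
Proof. by case: s. Qed.

Lemma of_real0 : of_real s 0 = 0 :> K.
Proof. by case: s. Qed.

Lemma of_real1 : of_real s 1 = 1 :> K.
Proof. by case: s. Qed.

Lemma of_realD t u : of_real s (t + u) = of_real s t + of_real s u.
Proof. by case: s => //=; rewrite rmorphD. Qed.

Lemma of_realM t u : of_real s (t * u) = of_real s t * of_real s u.
Proof. by case: s => //=; rewrite rmorphM. Qed.

Lemma re0 : re (0 : K) = 0.
Proof. by case: s. Qed.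

Lemma reD z w : re (z + w) = re z + re w.
Proof. by case: s z w => //= -[a b] [c d]. Qed.

Lemma re_of_realM t z : re (of_real s t * z) = t * re z.
Proof. by case: s z => //= -[a b] /=; rewrite mul0r subr0. Qed.

Lemma le_re z w : z <= w -> re z <= re w.
Proof. by case: s z w => //= z w; rewrite lecE => /andP[]. Qed.

Lemma re_ge0 z : 0 <= z -> 0 <= re z.
Proof. by move=> /le_re; rewrite re0. Qed.

Lemma reK z : 0 <= z -> of_real s (re z) = z.
Proof. by case: s z => //= z /ger0_real /RRe_real. Qed.

Lemma le_of_real t u : t <= u -> of_real s t <= of_real s u.
Proof. by case: s => //= tu; rewrite lecE /= eqxx. Qed.

Lemma of_real_ge0 t : 0 <= t -> 0 <= of_real s t.
Proof. by move=> /le_of_real; rewrite of_real0. Qed.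

Lemma re_le_norm z : re z <= re `|z|.
Proof.
case: s z => /= z; first exact: ler_norm.
have /le_trans : (complex.Re z)%:C%C <= `|complex.Re z|%:C%C :> R[i].
  by rewrite lecE /= eqxx ler_norm.
by move=> /(_ _ (normc_ge_Re z)); rewrite lecE => /andP[].
Qed.

Lemma re_gt0 z : 0 < z -> 0 < re z.
Proof.
move=> z0; rewrite lt_def (re_ge0 (ltW z0)) andbT; apply/eqP => rez.
by have := z0; rewrite -(reK (ltW z0)) rez of_real0 ltxx.
Qed.

Lemma of_real_gt0 t : 0 < t -> 0 < of_real s t.
Proof.
move=> t0; rewrite lt_def (of_real_ge0 (ltW t0)) andbT.
by apply/eqP => /(congr1 re) /eqP; rewrite of_realK re0 gt_eqF.
Qed.

Lemma lt_re z w : 0 <= z -> 0 <= w -> re z < re w -> z < w.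
Proof.
move=> z0 w0 zw; rewrite lt_def -(reK z0) -(reK w0) (le_of_real (ltW zw)) andbT.
by apply/eqP => /(can_inj of_realK) e; move: zw; rewrite e ltxx.
Qed.

(** Over C, the form x |-> f x - i f (i x) has real part f. *)
Lemma complexification (V : lmodType K) (f : V -> R) :
  {morph f : x y / x + y} ->
  (forall t x, f (of_real s t *: x) = t * f x) ->
  exists2 F : V -> K, scalar F & forall x, re (F x) = f x.
Proof.
case: s V f => /= V f fD fZ.
  by exists f => // a x y; rewrite fD fZ.
have fi x : f ('i%C *: ('i%C *: x)) = - f x.
  by rewrite scalerA -expr2 sqr_i -[-1](rmorphN1 (real_complex R)) fZ mulN1r.
exists (fun x => (f x -i* f ('i%C *: x))%C) => // -[a b] x y.
have split_scale v :
    ((a +i* b)%C : R[i]) *: v = a%:C%C *: v + b%:C%C *: ('i%C *: v).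
  rewrite scalerA -scalerDl; congr (_ *: v).
  by apply/eqP; rewrite eq_complex /= !(mul0r,mulr0,mulr1,subr0,addr0,add0r) !eqxx.
rewrite scalerDr scalerA mulrC -scalerA !split_scale !fD !fZ fi.
apply/eqP; rewrite eq_complex /=; apply/andP; split; apply/eqP; first by ring.
by ring.
Qed.

End ScalarTheory.

(** * The Hahn-Banach theorem *)

Section HahnBanach.
Variables (R : realType) (s : scalars) (V : lmodType (scalar_field R s)).
Local Notation "t *r x" := (of_real s t *: x) (at level 40).
Implicit Types (p q : V -> R) (x y w : V).

Definition sublinear q :=
  (forall x y, q (x + y) <= q x + q y) /\
  (forall (t : R) x, 0 <= t -> q (t *r x) <= t * q x).

Lemma sublinear0 q : sublinear q -> q 0 = 0.
Proof.
move=> [qD qZ]; apply/eqP; rewrite eq_le; apply/andP; split.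
  by have := qZ 0 0 (lexx 0); rewrite scaler0 mul0r.
by have := qD 0 0; rewrite addr0 -lerBlDr subrr.
Qed.

Lemma sublinearZ q t x : sublinear q -> 0 <= t -> q (t *r x) = t * q x.
Proof.
move=> sq; have [qD qZ] := sq; rewrite le_eqVlt => /predU1P[<-|t0].
  by rewrite of_real0 scale0r mul0r sublinear0.
apply/eqP; rewrite eq_le (qZ _ _ (ltW t0))/= -ler_pdivlMl//.
have := qZ t^-1 (t *r x); rewrite scalerA -of_realM mulVf ?gt_eqF//.
by rewrite of_real1 scale1r; apply; rewrite invr_ge0 ltW.
Qed.

Lemma sublinear_geN q x : sublinear q -> - q (- x) <= q x.
Proof.
move=> sq; have [qD _] := sq.
by rewrite lerNl -subr_ge0 opprK -(sublinear0 sq) -(addNr x) qD.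
Qed.

(** For sublinear [q], [tilt q w] is the greatest sublinear functional below [q]
    whose value at [- w] is at most [- q w], the value there of a linear form
    that agrees with [q] at [w]. *)
Definition tilt q w x := inf [set q (x + t *r w) - t * q w | t in [set t | 0 <= t]].

Section Tilt.
Variables (q : V -> R) (w : V).
Hypothesis sq : sublinear q.

Lemma tilt_le x t : 0 <= t -> tilt q w x <= q (x + t *r w) - t * q w.
Proof.
move=> t0; apply: ge_inf; last by exists t.
exists (- q (- x)) => _ [u /= u0 <-]; have [qD _] := sq.
have := qD (x + u *r w) (- x); rewrite addrAC subrr add0r sublinearZ//; lra.
Qed.

Lemma le_tilt x r :
  (forall t, 0 <= t -> r <= q (x + t *r w) - t * q w) -> r <= tilt q w x.
Proof.
move=> h; apply: lb_le_inf => [|_ [t t0 <-]]; last exact: h.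
by exists (q (x + 0 *r w) - 0 * q w), 0 => //=.
Qed.

Lemma tilt_le_self x : tilt q w x <= q x.
Proof. by have := tilt_le x (lexx 0); rewrite of_real0 scale0r mul0r addr0 subr0. Qed.

Lemma tilt_opp : tilt q w (- w) <= - q w.
Proof.
have := tilt_le (- w) ler01.
by rewrite of_real1 scale1r addNr (sublinear0 sq) mul1r sub0r.
Qed.

Lemma tilt_sublinear : sublinear (tilt q w).
Proof.
have [qD qZ] := sq; split=> [x y|t x].
  rewrite -lerBlDr; apply: le_tilt => t t0; rewrite lerBlDr -lerBlDl.
  apply: le_tilt => u u0; rewrite lerBlDl.
  have := tilt_le (x + y) (addr_ge0 t0 u0).
  have := qD (x + t *r w) (y + u *r w).
  rewrite addrACA -scalerDl -of_realD; lra.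
rewrite le_eqVlt => /predU1P[<-|t0].
  rewrite of_real0 scale0r mul0r (le_trans (tilt_le_self _))//.
  by rewrite (sublinear0 sq).
rewrite mulrC -ler_pdivrMr//; apply: le_tilt => u u0; rewrite ler_pdivrMr//.
have := tilt_le (t *r x) (mulr_ge0 (ltW t0) u0).
rewrite of_realM -scalerA -scalerDr (sublinearZ _ sq (ltW t0)).
by rewrite mulrBl [t * _]mulrC [t * u]mulrC mulrAC.
Qed.

End Tilt.

(** Zorn's lemma applies because the pointwise infimum of a chain is sublinear; it
    is finite because a sublinear [q] below [p] is bounded below by
    [x |-> - p (- x)]. *)
Lemma minimal_sublinear p : sublinear p ->
  exists q, [/\ sublinear q, forall x, q x <= p x &
    forall q', sublinear q' -> (forall x, q' x <= q x) -> q' = q].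
Proof.
move=> sp.
pose T := {q : V -> R | sublinear q /\ forall x, q x <= p x}.
pose below (q q' : T) := `[< forall x, sval q' x <= sval q x >].
have [||||m0 mmin] := @Zorn T below.
- by move=> q; apply/asboolP.
- move=> q1 q2 q3 /asboolP h1 /asboolP h2; apply/asboolP => x.
  exact: le_trans (h2 x) (h1 x).
- move=> [q1 q1P] [q2 q2P] /asboolP /= h1 /asboolP /= h2.
  have e : q1 = q2 by apply/funext => x; apply/eqP; rewrite eq_le h1 h2.
  by case: _ / e q2P {h1 h2} => q2P; rewrite (Prop_irrelevance q1P q2P).
- move=> C Ctot.
  have [[q0 Cq0]|Cempty] := pselect (C !=set0); last first.
    have sp' : sublinear p /\ forall x, p x <= p x by [].
    by exists (exist _ p sp') => q Cq; exfalso; apply: Cempty; exists q.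
  pose m x := inf [set sval q x | q in C].
  have mle (q : T) x : C q -> m x <= sval q x.
    move=> Cq; apply: ge_inf; last by exists q.
    exists (- p (- x)) => _ [q' _ <-]; have [sq' q'p] := svalP q'.
    by rewrite (le_trans _ (sublinear_geN x sq'))// lerN2.
  have le_m r x : (forall q : T, C q -> r <= sval q x) -> r <= m x.
    move=> h; apply: lb_le_inf; first by exists (sval q0 x), q0.
    by move=> _ [q Cq <-]; exact: h.
  have sm : sublinear m.
    split=> [x y|t x t0].
      rewrite -lerBlDr; apply: (le_m) => q1 Cq1; rewrite lerBlDr -lerBlDl.
      apply: (le_m) => q2 Cq2; rewrite lerBlDl.
      have [q [Cq qq1 qq2]] : exists q : T, [/\ C q, sval q x <= sval q1 x
          & sval q y <= sval q2 y].
        by have [/asboolP h|/asboolP h] := Ctot _ _ Cq1 Cq2;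
          [exists q2|exists q1].
      have [[qD _] _] := svalP q.
      by rewrite (le_trans (mle q _ Cq))// (le_trans (qD x y))// lerD.
    move: t0; rewrite le_eqVlt => /predU1P[<-|t0].
      have [sq0 _] := svalP q0.
      rewrite of_real0 scale0r mul0r (le_trans (mle q0 _ Cq0))//.
      by rewrite (sublinear0 sq0).
    rewrite mulrC -ler_pdivrMr//; apply: (le_m) => q Cq.
    have [[_ qZ] _] := svalP q.
    by rewrite ler_pdivrMr// mulrC (le_trans (mle q _ Cq))// qZ// ltW.
  have mp : sublinear m /\ forall x, m x <= p x.
    split=> // x; have [_ q0p] := svalP q0.
    exact: le_trans (mle q0 x Cq0) (q0p x).
  by exists (exist _ m mp) => q Cq; apply/asboolP => x; exact: mle.
have [sm mp] := svalP m0; exists (sval m0); split=> // q' sq' q'm.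
have q'p : sublinear q' /\ forall x, q' x <= p x.
  by split=> // x; exact: le_trans (q'm x) (mp x).
by rewrite -(mmin (exist _ q' q'p))//; apply/asboolP.
Qed.

(** By minimality [q] equals each [tilt q x], whence [q (- x) = - q x]; an odd
    sublinear functional is linear. *)
Lemma minimal_sublinear_linear q : sublinear q ->
  (forall q', sublinear q' -> (forall x, q' x <= q x) -> q' = q) ->
  {morph q : x y / x + y} /\ forall t x, q (t *r x) = t * q x.
Proof.
move=> sq qmin; have [qD _] := sq.
have qN x : q (- x) = - q x.
  apply/eqP; rewrite eq_le [X in _ && X]lerNl sublinear_geN// andbT.
  by rewrite -{1}(qmin _ (tilt_sublinear x sq) (tilt_le_self x sq)) tilt_opp.
split=> [x y|t x].
  apply/eqP; rewrite eq_le qD /=.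
  by have := qD (- x) (- y); rewrite -opprD !qN -opprD lerN2.
have [t0|t0] := leP 0 t; first exact: sublinearZ.
have := sublinearZ x sq (_ : 0 <= - t); rewrite oppr_ge0 => /(_ (ltW t0)).
have -> : of_real s (- t) = - of_real s t.
  by apply/eqP; rewrite -addr_eq0 -of_realD addNr of_real0.
by rewrite scaleNr qN mulNr => /oppr_inj.
Qed.

(** A minimal sublinear functional below [tilt p w], rather than below [p], has
    value [p w] at [w]. *)
Theorem Hahn_Banach_real p w : sublinear p ->
  exists f : V -> R, [/\ {morph f : x y / x + y},
    forall t x, f (t *r x) = t * f x, forall x, f x <= p x & f w = p w].
Proof.
move=> sp; have st := tilt_sublinear w sp.
have [f [sf ft fmin]] := minimal_sublinear st.
have [fD fZ] := minimal_sublinear_linear sf fmin.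
have fp x : f x <= p x := le_trans (ft x) (tilt_le_self w sp x).
exists f; split=> //; apply/eqP; rewrite eq_le fp /=.
have fN : f (- w) = - f w.
  by apply/eqP; rewrite -addr_eq0 -fD addNr (sublinear0 sf).
by rewrite -lerN2 -fN (le_trans (ft _))// tilt_opp.
Qed.

(** The second condition is an equality for [a <> 0], as its instance at [a^-1]
    shows. *)
Definition seminorm (N : V -> R) :=
  (forall x y, N (x + y) <= N x + N y) /\
  (forall a x, N (a *: x) <= re `|a| * N x).

(** The real form dominated by [N] is the real part of a form [F] over the scalar
    field, and multiplying [x] by a scalar of modulus 1 makes [F x] equal to its
    own modulus, so that [N] bounds [F] as well. *)
Theorem Hahn_Banach_seminorm N w : seminorm N ->
  exists F : V -> scalar_field R s,
    [/\ scalar F, forall x, re `|F x| <= N x & re (F w) = N w].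
Proof.
move=> [ND NZ].
have sN : sublinear N.
  split=> // t x t0; rewrite (le_trans (NZ _ _))//.
  by rewrite ger0_norm ?of_real_ge0// of_realK.
have [f [fD fZ fN fw]] := Hahn_Banach_real w sN.
have [F Fl reF] := complexification fD fZ.
exists F; split=> // [x|]; last by rewrite reF.
have F0 : F 0 = 0.
  have := Fl (-1) 0 0; rewrite scaler0 add0r => /eqP.
  by rewrite mulN1r addNr => /eqP.
have [Fx0|Fx0] := eqVneq (F x) 0.
  (* [0 <= N x] follows from [0 = N (x - x) <= N x + N (- x) <= N x + N x]. *)
  rewrite Fx0 normr0 re0.
  have := ND x (- x); rewrite subrr (sublinear0 sN) => h.
  have := NZ (-1) x; rewrite scaleN1r normrN1 -(of_real1 R s) of_realK mul1r; lra.
pose a := `|F x| / F x.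
have Fa : F (a *: x) = `|F x|.
  by have := Fl a x 0; rewrite !addr0 F0 addr0 => ->; rewrite /a divfK.
have na : `|a| = 1 by rewrite normrM normfV normr_id divff// normr_eq0.
rewrite -Fa reF (le_trans (fN _))// (le_trans (NZ _ _))//.
by rewrite na -(of_real1 R s) of_realK mul1r.
Qed.

End HahnBanach.

(** * The canonical embedding in the bidual *)

Section NormDuality.
Variables (R : realType) (s : scalars).
Local Notation K := (scalar_field R s).
Implicit Types V W : normedModType K.

Lemma re_normD V (x y : V) : re `|x + y| <= re `|x| + re `|y|.
Proof. by rewrite -reD; apply/le_re/ler_normD. Qed.

Lemma re_normZ V (a : K) (x : V) : re `|a *: x| = re `|a| * re `|x|.
Proof. by rewrite normrZ -{1}(reK (normr_ge0 a)) re_of_realM. Qed.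

Lemma le_norm_re V W (x : V) (y : W) : re `|x| <= re `|y| -> `|x| <= `|y|.
Proof. by move=> /(le_of_real s); rewrite !reK. Qed.

(** Some functional of norm at most 1 takes a value of real part [`|v|] at [v]. *)
Lemma le_norm_bidual V (v : V) : `|v| <= `|bidual_map v|.
Proof.
have sn : seminorm (fun x : V => re `|x|).
  by split=> [x y|a x]; [exact: re_normD | rewrite re_normZ].
have [F [Fl Fle Fv]] := Hahn_Banach_seminorm v sn.
have Fb x : `|F x| <= 1 * `|x| by rewrite mul1r; exact/le_norm_re/Fle.
have Fd : is_dual F by split=> //; apply/(is_dual_bounded Fl); exists 1.
have F1 : `|mkdual Fd| <= 1 by rewrite dual_normE dual_norm_bound.
apply: (@le_trans _ _ `|F v|).
  apply: (@le_norm_re V K^o); rewrite -Fv; exact: re_le_norm.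
have /le_trans := dual_normM (bidual_map v) (mkdual Fd); apply.
by rewrite -dual_normE ler_piMr.
Qed.

Lemma norm_bidual_le V (v : V) : `|bidual_map v| <= `|v|.
Proof. by apply: dual_norm_bound => // f; rewrite mulrC; exact: (dual_normM f v). Qed.

Lemma bidual_linear V : linear (@bidual_map R s V).
Proof. by move=> a x y; apply: dual_ext => f /=; rewrite dual_scalar. Qed.

(** The value of [Phi] at the image of [v] is [f v], so that [f] is zero. *)
Lemma bidual_map_eq0 V (f : dual V) (Phi : dual (dual (dual V))) :
  Phi = bidual_map f -> (forall v, Phi (bidual_map v) = 0) -> Phi = 0.
Proof.
move=> -> h; have -> : f = 0 by apply: dual_ext => v; exact: (h v).
by apply: dual_ext => g /=; rewrite linear0.
Qed.

End NormDuality.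

(** * Distance to the range of a linear map *)

Section Distance.
Variables (R : realType) (s : scalars).
Local Notation K := (scalar_field R s).
Variables (V W : normedModType K) (i : V -> W).
Hypothesis il : linear i.

Definition dist_range (w : W) : R := inf [set re `|w - i v| | v in [set: V]].

Lemma dist_range_le w v : dist_range w <= re `|w - i v|.
Proof. by apply: ge_inf; [exists 0 => _ [u _ <-]; exact: re_ge0 | exists v]. Qed.

Lemma le_dist_range w r : (forall v, r <= re `|w - i v|) -> r <= dist_range w.
Proof.
move=> h; apply: lb_le_inf => [|_ [v _ <-]]; last exact: h.
by exists (re `|w - i 0|), 0.
Qed.

Lemma seminorm_dist_range : seminorm dist_range.
Proof.
have iD x y : i (x + y) = i x + i y by rewrite -[x in LHS]scale1r il scale1r.
have i0 : i 0 = 0 by apply: (addrI (i 0)); rewrite -iD !addr0.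
have iZ a x : i (a *: x) = a *: i x by have := il a x 0; rewrite i0 !addr0.
split=> [x y|a x].
  rewrite -lerBlDr; apply: le_dist_range => u; rewrite lerBlDr -lerBlDl.
  apply: le_dist_range => v; rewrite lerBlDl.
  rewrite (le_trans (dist_range_le _ (u + v)))// iD opprD addrACA.
  exact: re_normD.
have [->|a0] := eqVneq a 0.
  rewrite scale0r normr0 re0 mul0r (le_trans (dist_range_le _ 0))//.
  by rewrite i0 subrr normr0 re0.
have na : 0 < re `|a| by rewrite re_gt0// normr_gt0.
rewrite mulrC -ler_pdivrMr//; apply: le_dist_range => v.
rewrite ler_pdivrMr// mulrC -re_normZ scalerBr -iZ.
exact: dist_range_le.
Qed.

Lemma dist_range_norm w : dist_range w <= re `|w|.
Proof.
have i0 : i 0 = 0 by have := il (-1) 0 0; rewrite scaler0 addr0 scaleN1r addNr.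
by rewrite (le_trans (dist_range_le w 0))// i0 subr0.
Qed.

Lemma dist_range_image v : dist_range (i v) = 0.
Proof.
apply/eqP; rewrite eq_le; apply/andP; split.
  by rewrite (le_trans (dist_range_le _ v))// subrr normr0 re0.
by apply: le_dist_range => u; exact: re_ge0.
Qed.

End Distance.

(** The sets of [v] with [i v] close to [w] generate a filter, which is Cauchy
    because [i] is isometric; [i] maps its limit to [w]. *)
Lemma closed_isometric_range (R : realType) (s : scalars)
    (V : completeNormedModType (scalar_field R s))
    (W : normedModType (scalar_field R s)) (i : V -> W) w :
  linear i -> (forall v, `|v| <= `|i v|) -> (forall v, `|i v| <= `|v|) ->
  dist_range i w = 0 -> range i w.
Proof.
move=> il ige ile d0.
have iB x y : i (x - y) = i x - i y.
  by rewrite addrC -scaleN1r il scaleN1r addrC.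
pose near_w (e : R) := [set v : V | re `|w - i v| < e].
pose F := filter_from [set e : R | 0 < e] near_w.
have FF : ProperFilter F.
  apply: filter_from_proper; last first.
    move=> e /= e0.
    have := @inf_adherent R [set re `|w - i v| | v in [set: V]] _ e0.
    rewrite -/(dist_range i w) d0 add0r => -[].
      split; first by exists (re `|w - i 0|), 0.
      by exists 0 => _ [u _ <-]; exact: re_ge0.
    by move=> _ [v _ <-] lt; exists v.
  apply: filter_from_filter; first by exists 1 => /=.
  move=> e1 e2 /= e10 e20; exists (Num.min e1 e2); first by rewrite /= lt_min e10.
  by move=> v; rewrite /near_w /= lt_min => /andP[].
have /cauchy_cvg/cvg_ex[v Fv] : cauchy F.
  apply: cauchy_exP => e e0; pose r := re e / 2.
  have r0 : 0 < r by rewrite divr_gt0// re_gt0.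
  have Fr : F (near_w r) by exists r.
  have [z wz] := filter_ex Fr.
  exists z; exists r => // y wy; rewrite -ball_normE /=.
  apply: (le_lt_trans (ige _)); rewrite iB; apply: lt_re => [//||]; first exact: ltW.
  have := @re_normD R s W (i z - w) (w - i y); rewrite addrA subrK => /le_lt_trans; apply.
  by rewrite -normrN opprB [re e]splitr ltrD.
exists v => //; apply/eqP; rewrite -subr_eq0 -normr_le0 -(reK (normr_ge0 _)).
rewrite -(of_real0 R s) le_of_real//; apply/ler_addgt0Pl => e e0; rewrite addr0.
have e20 : 0 < e / 2 by rewrite divr_gt0.
have Fball : F (ball v (of_real s (e / 2))).
  by apply: Fv; apply: nbhsx_ballx; exact: of_real_gt0.
have Fnear : F (near_w (e / 2)) by exists (e / 2).
have [u [vu wu]] := filter_ex (filterI Fball Fnear).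
have := @re_normD R s W (i v - i u) (i u - w); rewrite addrA subrK => /le_trans; apply.
rewrite [e]splitr lerD//; last by rewrite -normrN opprB ltW.
rewrite -[leRHS](@of_realK R s) le_re// -iB (le_trans (ile _))// ltW//.
by move: vu; rewrite -ball_normE.
Qed.

(** * Reflexivity *)

Section Reflexivity.
Variables (R : realType) (s : scalars).
Local Notation K := (scalar_field R s).

(** If [Phi] were outside the closed canonical image of [V], the distance to that
    image would be a seminorm nonzero at [Phi], and Hahn-Banach would give a
    form [F], nonzero at [Phi], that vanishes on the image of [V]. *)
Theorem reflexive_predual (V : completeNormedModType K) :
  reflexive_space (dual V) -> reflexive_space V.
Proof.
move=> rdV; apply/seteqP; split=> // Phi _.
pose i := @bidual_map R s V; have il : linear i := @bidual_linear R s V.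
apply: (closed_isometric_range il (@le_norm_bidual R s V)
  (@norm_bidual_le R s V)).
have [F [Fl Fle FPhi]] := Hahn_Banach_seminorm Phi (seminorm_dist_range il).
have Fd : is_dual F.
  split=> //; apply/(is_dual_bounded Fl); exists 1 => // Psi; rewrite mul1r.
  by apply: (@le_norm_re R s K^o); exact: le_trans (Fle Psi) (dist_range_norm il Psi).
have [f _ fF] : range (@bidual_map R s (dual V)) (mkdual Fd) by rewrite rdV.
have F0 : mkdual Fd = 0.
  apply: (bidual_map_eq0 (esym fF)) => v.
  apply/eqP; rewrite -normr_le0 -(normr0 K) //=.
  apply: (@le_norm_re R s K^o K^o); rewrite normr0 re0.
  by rewrite -(dist_range_image i v); exact: Fle.
by rewrite -FPhi -[F Phi]/(mkdual Fd Phi) F0 re0.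
Qed.

Definition bounded_map (V W : normedModType K) (T : V -> W) :=
  exists2 M : K, 0 <= M & forall x, `|T x| <= M * `|x|.

Section Precomposition.
Variables (V W : normedModType K) (T : V -> W).
Hypotheses (Tl : linear T) (Tb : bounded_map T).

Lemma precomp_subproof (g : dual W) : is_dual (g \o T).
Proof.
have l : scalar (g \o T) by move=> a x y /=; rewrite Tl dual_scalar.
split=> //; apply/(is_dual_bounded l); have [M M0 TM] := Tb.
exists (`|g| * M); first by rewrite mulr_ge0.
move=> x /=; rewrite -mulrA; have /le_trans := dual_normM g (T x); apply.
by rewrite ler_wpM2l ?dual_norm_ge0.
Qed.

Definition precomp (g : dual W) : dual V := mkdual (precomp_subproof g).

Lemma precomp_linear : linear precomp.
Proof. by move=> a f g; exact: dual_ext. Qed.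

Lemma precomp_bounded : bounded_map precomp.
Proof.
have [M M0 TM] := Tb; exists M => // g; apply: dual_norm_bound.
  by rewrite mulr_ge0.
move=> x /=; have /le_trans := dual_normM g (T x); apply.
by rewrite [M * _]mulrC -mulrA ler_wpM2l ?dual_norm_ge0.
Qed.

End Precomposition.

Lemma bidual_bounded (V : normedModType K) : bounded_map (@bidual_map R s V).
Proof. by exists 1 => // v; rewrite mul1r norm_bidual_le. Qed.

(** Transport [Phi] to the bidual of [W] along [i], represent it there by [w],
    and test the equality on the functionals [f \o p]. *)
Lemma reflexive_retract (V W : normedModType K) (i : V -> W) (p : W -> V) :
  linear i -> bounded_map i -> linear p -> bounded_map p -> cancel i p ->
  reflexive_space W -> reflexive_space V.
Proof.
move=> il ib pl pb ip rW; apply/seteqP; split=> // Phi _.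
have [w _ wPhi] : range (@bidual_map R s W)
    (precomp (precomp_linear il ib) (precomp_bounded il ib) Phi) by rewrite rW.
exists (p w) => //; apply: dual_ext => f.
have := congr1 (fun G : dual (dual W) => G (precomp pl pb f)) wPhi => /= ->.
by congr (Phi _); apply: dual_ext => v /=; rewrite ip.
Qed.

(** The restriction to [V] of functionals on its bidual is a left inverse of the
    canonical embedding of [dual V]. *)
Lemma reflexive_dual_bidual (V : normedModType K) :
  reflexive_space (dual (dual (dual V))) -> reflexive_space (dual V).
Proof.
have bl := @bidual_linear R s V; have bb := @bidual_bounded V.
apply: (@reflexive_retract _ _ (@bidual_map R s (dual V)) (precomp bl bb)).
- exact: bidual_linear.
- exact: bidual_bounded.
- exact: precomp_linear.
- exact: precomp_bounded.
- by move=> f; exact: dual_ext.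
Qed.

(** Each step goes down by two duals. *)
Lemma reflexive_odd_dual (V : normedModType K) k :
  reflexive_space (iter_dual V k.*2.+1) -> reflexive_space (dual V).
Proof. by elim: k => // k IH /reflexive_dual_bidual. Qed.

(** Every [Phi] equals its own product with [e]. *)
Lemma reflexive_left_unit (A B : normedModType K) (e : A)
    (m : bbilin A (dual B) (dual B)) :
  (forall b, m e b = b) ->
  [set adj m b' a | b' in [set: dual (dual B)] & a in [set: A]] `<=`
    range (@bidual_map R s B) ->
  reflexive_space B.
Proof.
move=> me mB; apply/seteqP; split=> // Phi _; apply: mB.
exists Phi => //; exists e => //; apply: dual_ext => b.
by rewrite adjE me.
Qed.

End Reflexivity.

(** * Weak-star continuity of module actions *)

Section LeftCentresTopology.
Variables (R : realType) (s : scalars).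
Local Notation K := (scalar_field R s).

Lemma continuous_to_ptws (T U : topologicalType) (X : Type)
    (f : T -> {ptws X -> U}) :
  (forall x, continuous (fun t => f t x)) -> continuous f.
Proof.
move=> fx t; apply/cvg_sup => x.
apply: (@continuous_comp_initial (X -> U) T U (fun h => h x) f).
exact: fx.
Qed.

Lemma continuous_weak_star_eval (V : normedModType K) (v : V) :
  continuous (fun f : weak_star V => (f : dual V) v).
Proof.
move=> f; apply: (@continuous_comp _ _ _
  (fun f : weak_star V => ((f : dual V) : {ptws V -> K})) (fun h => h v)).
  exact: initial_continuous.
exact: proj_continuous.
Qed.

Section LeftCentres.
Variables (V W X : normedModType K) (r : bbilin X (dual V) (dual W)).
Hypothesis rV : [set adj r b' b | b' in [set: dual (dual W)] & b in [set: X]]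
  `<=` range (@bidual_map R s V).

(** This functional of [a] is the product of [b'] and [b], hence evaluation at a
    point of [V]. *)
Lemma continuous_weak_star_functional (b' : dual (dual W)) (b : X) :
  continuous (fun a : weak_star V => b' (r b a)).
Proof.
have [v _ vE] : range (@bidual_map R s V) (adj r b' b).
  by apply: rV; exists b' => //; exists b.
have -> : (fun a : weak_star V => b' (r b a)) = (fun a => (a : dual V) v).
  by apply/funext => a; rewrite -adjE -vE.
exact: continuous_weak_star_eval.
Qed.

Lemma Zl_tilde_setT : Zl_tilde V W r = setT.
Proof.
apply/seteqP; split=> // b _; apply: continuous_comp_initial.
apply: continuous_to_ptws => b'; exact: continuous_weak_star_functional.
Qed.

(** The weak* topology of [dual W] is tested by those functionals [b'] on
    [dual W] that come from [W]. *)
Lemma Zl_setT : Zl V W r = setT.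
Proof.
apply/seteqP; split=> // b _; apply: continuous_comp_initial.
apply: continuous_to_ptws => w.
exact: (@continuous_weak_star_functional (bidual_map w) b).
Qed.

End LeftCentres.

End LeftCentresTopology.

Unset Implicit Arguments.

(* n = k.*2.+3 runs over the odd numbers n >= 2, so that n - 1 = k.*2.+2 is
   k.+1.*2 and n - 2 = k.*2.+1. *)
Theorem mainTheorem4 (R : realType) (s : scalars)
    (A : banach_algebra R s) (B : banach_bimodule A) (k : nat) :
  let mulA := arens (amul A) k.+1 in
  let actl := arens (lact B) k.+1 in
  let actr := arens (ract B) k.+1 in
  ([set adj actr b' b | b' in [set: iter_dual B k.*2.+3]
                      & b in [set: iter_dual B k.*2.+2]]
     `<=` range (@bidual_map R s (iter_dual A k.*2.+1)) ->
   Zl (iter_dual A k.*2.+1) (iter_dual B k.*2.+1) actr =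
   Zl_tilde (iter_dual A k.*2.+1) (iter_dual B k.*2.+1) actr)
  /\
  ([set adj actl b' a | b' in [set: iter_dual B k.*2.+3]
                      & a in [set: iter_dual A k.*2.+2]]
     `<=` range (@bidual_map R s (iter_dual B k.*2.+1)) ->
   (exists e : iter_dual A k.*2.+2,
      (forall a, mulA e a = a) /\ (forall b, actl e b = b)) ->
   reflexive_space B).
Proof.
move=> mulA actl actr; split=> [hA|hB [e [_ eb]]].
  by rewrite Zl_setT// Zl_tilde_setT.
apply: reflexive_predual; apply: (@reflexive_odd_dual _ _ _ k).
exact: (reflexive_left_unit eb hB).
Qed.
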